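(* Memoryless Markov embeddings are m-geodesic affine: if $L_\star\colon\mathcal{W}(\mathcal{X},\mathcal{D})\to\mathcal{W}(\mathcal{Y},\mathcal{E})$ is a memoryless Markov embedding, then for all $\bar P_0,\bar P_1\in\mathcal{W}(\mathcal{X},\mathcal{D})$, $L_\star\gamma^{(m)}_{\bar P_0,\bar P_1}=\gamma^{(m)}_{L_\star\bar P_0,L_\star\bar P_1}$.
   Context: All vertex sets are finite with at least two elements; $(\mathcal{X},\mathcal{D})$, $(\mathcal{Y},\mathcal{E})$ are strongly connected digraphs. $\mathcal{W}(\mathcal{Y},\mathcal{E})$ is the set of row-stochastic matrices on $\mathcal{Y}$ strictly positive on $\mathcal{E}$ and zero outside (similarly for $(\mathcal{X},\mathcal{D})$). Memoryless Markov embedding $L_\star\colon\mathcal{W}(\mathcal{X},\mathcal{D})\to\mathcal{W}(\mathcal{Y},\mathcal{E})$: there are a surjective map $\kappa\colon\mathcal{Y}\to\mathcal{X}$ with $\{(\kappa(y),\kappa(y')):(y,y')\in\mathcal{E}\}=\mathcal{D}$ and a function $L\colon\mathcal{Y}\to\mathbb{R}$ such that the matrix $\Lambda(y,y')=L(y')$ if $(\kappa(y),\kappa(y'))\in\mathcal{D}$ and $0$ otherwise, is strictly positive on $\mathcal{E}$ and zero outside $\mathcal{E}$, and $(\Lambda(y,y'))_{y'\in\kappa^{-1}(x')}$ is a probability distribution on $\kappa^{-1}(x')$ whenever $(\kappa(y),x')\in\mathcal{D}$; the embedding is $L_\star\bar P(y,y')=\bar P(\kappa(y),\kappa(y'))L(y')$.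 m-geodesic: for $P_0,P_1\in\mathcal{W}(\mathcal{Y},\mathcal{E})$ with stationary distributions $\pi_0,\pi_1$, edge measures $Q_i(y,y')=\pi_i(y)P_i(y,y')$ and $Q_t=(1-t)Q_0+tQ_1$, $\gamma^{(m)}_{P_0,P_1}(t)$ is the unique element of $\mathcal{W}(\mathcal{Y},\mathcal{E})$ whose edge measure is $Q_t$, defined for $t\in I=\{t\in\mathbb{R}:Q_t>0\text{ on }\mathcal{E}\}\supset[0,1]$. Equality of geodesics is equality as functions of $t$. *)

(* Defs.v *)
From HB Require Import structures.
From mathcomp Require Import all_boot all_order all_algebra.
From mathcomp Require Import boolp classical_sets reals.

Set Implicit Arguments.
Unset Strict Implicit.
Unset Printing Implicit Defensive.

Import Order.TTheory GRing.Theory Num.Theory.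
Local Open Scope ring_scope.

(* A digraph on a finite vertex set V is given by its edge set
   D : {set V * V}; loops are allowed. *)
Definition strongly_connected (V : finType) (D : {set V * V}) : Prop :=
  forall x x' : V, connect [rel u v | (u, v) \in D] x x'.

(* Matrices indexed by V are finite functions on V * V, P (x, x') being the
   entry in row x and column x'. *)
Definition is_transition (R : realType) (V : finType) (D : {set V * V})
    (P : {ffun V * V -> R}) : bool :=
  [forall x, \sum_x' P (x, x') == 1] &&
  [forall e, if e \in D then 0 < P e else P e == 0].

(* The set W(V, D), as a subtype of the matrices indexed by V. *)
Record transition (R : realType) (V : finType) (D : {set V * V}) := Transition {
  tmat :> {ffun V * V -> R};
  _ : is_transition D tmat }.

HB.instance Definition _ (R : realType) (V : finType) (D : {set V * V}) :=
  [isSub for @tmat R V D].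
HB.instance Definition _ (R : realType) (V : finType) (D : {set V * V}) :=
  [Choice of transition R D by <:].

Definition is_stationary (R : realType) (V : finType) (D : {set V * V})
    (P : transition R D) (p : {ffun V -> R}) : Prop :=
  [/\ forall x, 0 <= p x,
      \sum_x p x = 1 &
      forall x', \sum_x p x * P (x, x') = p x'].

(* There is exactly one stationary distribution when D is strongly connected
   and V is nonempty; the default value 0 is then irrelevant. *)
Definition stationary (R : realType) (V : finType) (D : {set V * V})
    (P : transition R D) : {ffun V -> R} :=
  xget [ffun=> 0] (is_stationary P).

Definition edge_measure (R : realType) (V : finType) (D : {set V * V})
    (P : transition R D) : {ffun V * V -> R} :=
  [ffun e => stationary P e.1 * P e].

Definition m_mixture (R : realType) (V : finType) (D : {set V * V})
    (P0 P1 : transition R D) (t : R) : {ffun V * V -> R} :=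
  [ffun e => (1 - t) * edge_measure P0 e + t * edge_measure P1 e].

Definition m_geodesic_dom (R : realType) (V : finType) (D : {set V * V})
    (P0 P1 : transition R D) : set R :=
  [set t | forall e, e \in D -> 0 < m_mixture P0 P1 t e]%classic.

(* For t in m_geodesic_dom P0 P1 (D strongly connected, V nonempty) there is
   exactly one such P. The value at the other t is meaningless. *)
Definition m_geodesic (R : realType) (V : finType) (D : {set V * V})
    (P0 P1 : transition R D) (t : R) : transition R D :=
  xget P0 [set P | edge_measure P = m_mixture P0 P1 t]%classic.

Definition memoryless_weight (R : realType) (X Y : finType) (D : {set X * X})
    (kappa : Y -> X) (L : Y -> R) (y y' : Y) : R :=
  if (kappa y, kappa y') \in D then L y' else 0.

Definition memoryless_embedding (R : realType) (X Y : finType)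
    (D : {set X * X}) (E : {set Y * Y})
    (Lstar : transition R D -> transition R E) : Prop :=
  exists (kappa : Y -> X) (L : Y -> R),
    let Lambda := memoryless_weight D kappa L in
    [/\ forall x, exists y, kappa y = x,
        [set (kappa e.1, kappa e.2) | e in E] = D,
        forall y y',
          ((y, y') \in E -> 0 < Lambda y y') /\
          ((y, y') \notin E -> Lambda y y' = 0),
        forall y x', (kappa y, x') \in D ->
          (forall y', kappa y' = x' -> 0 <= Lambda y y') /\
          \sum_(y' | kappa y' == x') Lambda y y' = 1 &
        forall (P : transition R D) y y',
          Lstar P (y, y') = P (kappa y, kappa y') * L y'].

(* Main.v *)
(* The stationary distribution of [Lstar P] is [pi (kappa y) * L y], where [pi]
   is that of [P], because [L] sums to 1 over each fibre of [kappa]. Hence the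
   edge measure of [Lstar P] at [(y, y')] is
   [Q (kappa y, kappa y') * (L y * L y')], which is linear in the edge measure
   [Q] of [P], so that [Lstar] commutes with mixtures. *)
Require Import Defs.
From HB Require Import structures.
From mathcomp Require Import all_boot all_order all_algebra.
From mathcomp Require Import boolp classical_sets reals.

Set Implicit Arguments.
Unset Strict Implicit.
Unset Printing Implicit Defensive.

Import Order.TTheory GRing.Theory Num.Theory.
Local Open Scope ring_scope.

(** * Edges at a vertex of a strongly connected digraph *)

Section StronglyConnected.
Variables (V : finType) (D : {set V * V}).
Hypotheses (V_ge2 : (1 < #|V|)%N) (D_conn : strongly_connected D).

Lemma exists_neq (x : V) : exists y, y != x.
Proof.
have /card_gt0P[y yx] : (0 < #|predC1 x|)%N by rewrite cardC1 -ltnS prednK // ltnW.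
by exists y.
Qed.

(** A path from [x] to a different vertex is nonempty, and its first edge leaves [x]. *)
Lemma exists_out_edge (x : V) : exists x', (x, x') \in D.
Proof.
have [y /negP yx] := exists_neq x.
have /connectP[[|z p] /= path_p y_last] := D_conn x y; first by rewrite y_last in yx.
by case/andP: path_p => xz _; exists z.
Qed.

Lemma exists_in_edge (x' : V) : exists x, (x, x') \in D.
Proof.
have [y /negP yx] := exists_neq x'.
have /connectP[p] := D_conn y x'.
case/lastP: p => [|p z] /= path_p x'_last; first by rewrite x'_last in yx.
move: path_p; rewrite x'_last last_rcons rcons_path => /andP[_ zx].
by exists (last y p).
Qed.

End StronglyConnected.

(** * Stationary distributions: existence, uniqueness, positivity *)

Section Transition.
Variables (R : realType) (V : finType) (D : {set V * V}).
Implicit Types (P : transition R D) (v w : V -> R).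

Lemma transition_sum P x : \sum_x' P (x, x') = 1.
Proof. by case: P => P /= /andP[/forallP/(_ x)/eqP]. Qed.

Lemma transition_gt0 P e : e \in D -> 0 < P e.
Proof. by case: P => P /= /andP[_ /forallP/(_ e)] + De; rewrite De. Qed.

Lemma transition_eq0 P e : e \notin D -> P e = 0.
Proof.
by case: P => P /= /andP[_ /forallP/(_ e)] + /negbTE De; rewrite De => /eqP.
Qed.

Lemma transition_ge0 P e : 0 <= P e.
Proof.
by have [/transition_gt0/ltW//|/transition_eq0->] := boolP (e \in D).
Qed.

(** Left eigenvectors of [P] for the eigenvalue 1 (or zero), free of sign and mass conditions so
    that they can be combined linearly. *)
Definition invariant_vector P v := forall x', \sum_x v x * P (x, x') = v x'.

Lemma invariant_vectorD P v w : invariant_vector P v -> invariant_vector P w ->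
  invariant_vector P (fun x => v x + w x).
Proof.
move=> hv hw x'; rewrite -hv -hw -big_split /=.
by apply: eq_bigr => x _; rewrite mulrDl.
Qed.

Lemma invariant_vectorZ P a v : invariant_vector P v ->
  invariant_vector P (fun x => a * v x).
Proof.
by move=> hv x'; rewrite -hv mulr_sumr; apply: eq_bigr => x _; rewrite mulrA.
Qed.

(* [|v| <= |v| P] entrywise, and both sides have the same total mass. *)
Lemma invariant_vector_norm P v : invariant_vector P v ->
  invariant_vector P (fun x => `|v x|).
Proof.
move=> hv.
have le_norm x' : `|v x'| <= \sum_x `|v x| * P (x, x').
  rewrite -[in leLHS]hv; apply: le_trans (ler_norm_sum _ _ _) _.
  by apply: ler_sum => x _; rewrite normrM (ger0_norm (transition_ge0 _ _)).
have mass : \sum_x' (\sum_x `|v x| * P (x, x') - `|v x'|) = 0.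
  rewrite sumrB exchange_big /= -sumrB big1 // => x _.
  by rewrite -mulr_sumr transition_sum mulr1 subrr.
move=> x'; apply/eqP; rewrite -subr_eq0; apply/eqP.
by apply: (psumr_eq0P _ mass) => // y _; rewrite subr_ge0.
Qed.

Hypotheses (V_ge2 : (1 < #|V|)%N) (D_conn : strongly_connected D).

(** If [v] vanishes at a vertex, invariance there is a vanishing sum of nonnegative terms, so [v]
    vanishes at all its in-neighbours. Zeros thus spread backwards along a path from [y] to [x]. *)
Lemma invariant_vector_eq0 P v x : (forall z, 0 <= v z) ->
  invariant_vector P v -> v x = 0 -> forall y, v y = 0.
Proof.
move=> v_ge0 hv vx0 y; have /connectP[p] := D_conn y x.
elim: p y => [|z p IHp] y /= => [_ <-//|/andP[yz path_p] x_last].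
have vz0 : \sum_u v u * P (u, z) = 0 by rewrite hv; apply: IHp.
have /psumr_eq0P/(_ vz0 y isT)/eqP : forall u, true -> 0 <= v u * P (u, z).
  by move=> u _; rewrite mulr_ge0 ?transition_ge0.
by rewrite mulf_eq0 (gt_eqF (transition_gt0 P yz)) orbF => /eqP.
Qed.

(* [|v| - v] and [|v| + v] are nonnegative invariant vectors one of which
   vanishes at [x], hence everywhere: [v] has constant sign. *)
Lemma invariant_vector_sum0 P v : invariant_vector P v -> \sum_x v x = 0 ->
  forall x, v x = 0.
Proof.
move=> hv sum0 x.
have [s s1 sx] : exists2 s : R, `|s| = 1 & `|v x| = s * v x.
  have [v_ge0|v_lt0] := ger0P (v x).
    by exists 1; rewrite ?normr1 ?mul1r.
  by exists (- 1); rewrite ?normrN1 ?mulN1r.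
have norm_v y : `|v y| = s * v y.
  apply/eqP; rewrite -subr_eq0 -mulNr; apply/eqP.
  apply: (@invariant_vector_eq0 P (fun y => `|v y| + - s * v y) x) => [z||].
  - by rewrite mulNr subr_ge0 (le_trans (ler_norm _)) // normrM s1 mul1r.
  - exact/invariant_vectorD/invariant_vectorZ/hv/invariant_vector_norm.
  - by rewrite sx mulNr subrr.
have norm_sum0 : \sum_y `|v y| = 0.
  by under eq_bigr do rewrite norm_v; rewrite -mulr_sumr sum0 mulr0.
by apply/normr0_eq0/(psumr_eq0P _ norm_sum0).
Qed.

(* [P] fixes the constant column vector, so 1 is an eigenvalue of [P] and also
   has a left eigenvector. *)
Lemma exists_invariant_vector P :
  exists2 v, invariant_vector P v & exists x, v x != 0.
Proof.
pose A : 'M[R]_#|V| := \matrix_(i, j) P (enum_val i, enum_val j) - 1%:M.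
have V_gt0 : (0 < #|V|)%N by rewrite ltnW.
have /det0P[u u_neq0 /eqP] : \det A == 0.
  (* [det0P] speaks of row vectors, so the constant column vector killed by [A] is used on the
     transpose. *)
  rewrite -det_tr; apply/det0P; exists (const_mx 1).
    apply/eqP => /rowP/(_ (Ordinal V_gt0)); rewrite !mxE => /eqP.
    by rewrite oner_eq0.
  apply/rowP => i; rewrite !mxE.
  under eq_bigr do rewrite !mxE mul1r.
  rewrite sumrB [X in _ - X](bigD1 i) //= eqxx.
  rewrite [X in _ - (_ + X)]big1 => [|j]; last by rewrite eq_sym => /negbTE->.
  rewrite addr0 -(transition_sum P (enum_val i)).
  by rewrite [X in _ - X](reindex _ (onW_bij _ (@enum_val_bij V))) subrr.
rewrite mulmxBr mulmx1 subr_eq0 => /eqP/rowP uA.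
exists (fun x => u 0 (enum_rank x)).
  move=> x'; rewrite -uA mxE (reindex _ (onW_bij _ (@enum_val_bij V))) /=.
  by apply: eq_bigr => i _; rewrite mxE !enum_valK enum_rankK.
have /rV0Pn[i ui] := u_neq0.
by exists (enum_val i); rewrite enum_valK.
Qed.

(** Normalise the absolute value of a nonzero invariant vector. *)
Lemma exists_is_stationary P : exists p, is_stationary P p.
Proof.
have [v /invariant_vector_norm hv [x vx]] := exists_invariant_vector P.
have mass_gt0 : 0 < \sum_x `|v x|.
  rewrite (bigD1 x) //= ltr_pwDl ?normr_gt0 ?sumr_ge0 // => *; exact: normr_ge0.
exists [ffun x => (\sum_x `|v x|)^-1 * `|v x|]; split.
- by move=> y; rewrite ffunE mulr_ge0 // invr_ge0 ltW.
- under eq_bigr do rewrite ffunE.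
  by rewrite -mulr_sumr mulVf // gt_eqF.
- move=> y; rewrite ffunE -(invariant_vectorZ _ hv).
  by apply: eq_bigr => z _; rewrite ffunE.
Qed.

(** The difference [p - q] is an invariant vector of total mass 0. *)
Lemma is_stationary_unique P p q :
  is_stationary P p -> is_stationary P q -> p = q.
Proof.
move=> [_ p1 hp] [_ q1 hq]; apply/ffunP => x.
apply/eqP; rewrite -subr_eq0 -mulN1r; apply/eqP.
apply: (invariant_vector_sum0 (P := P) (v := fun x => p x + -1 * q x)) => //.
  exact/invariant_vectorD/invariant_vectorZ.
by rewrite big_split /= -mulr_sumr p1 q1 mulN1r subrr.
Qed.

Lemma stationaryP P : is_stationary P (stationary P).
Proof. by have [p] := exists_is_stationary P; exact: xgetI. Qed.

Lemma stationaryE P p : is_stationary P p -> stationary P = p.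
Proof. exact/is_stationary_unique/stationaryP. Qed.

(** A zero entry would spread to all vertices, against total mass 1. *)
Lemma stationary_gt0 P x : 0 < stationary P x.
Proof.
have [p_ge0 p1 hp] := stationaryP P.
rewrite lt_neqAle p_ge0 andbT eq_sym; apply/eqP => px0.
have p0 := invariant_vector_eq0 p_ge0 hp px0.
by move/eqP: p1; rewrite big1 // eq_sym oner_eq0.
Qed.

(** * Edge measures as coordinates on the set of transition matrices *)

Lemma edge_measure_eq0 P e : e \notin D -> edge_measure P e = 0.
Proof. by move=> De; rewrite ffunE transition_eq0 ?mulr0. Qed.

Lemma edge_measure_suml P x : \sum_x' edge_measure P (x, x') = stationary P x.
Proof.
by under eq_bigr do rewrite ffunE /=; rewrite -mulr_sumr transition_sum mulr1.
Qed.

Lemma edge_measure_sumr P x' : \sum_x edge_measure P (x, x') = stationary P x'.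
Proof.
by have [_ _ <-] := stationaryP P; apply: eq_bigr => x _; rewrite ffunE.
Qed.

(** The row sums recover the stationary distribution, which is positive and can be divided out. *)
Lemma edge_measure_inj : injective (@edge_measure R V D).
Proof.
move=> P P' PP'; apply/val_inj/ffunP => -[x x'] /=.
have pp' : stationary P x = stationary P' x by rewrite -!edge_measure_suml PP'.
have /ffunP/(_ (x, x')) := PP'; rewrite !ffunE /= pp'.
by apply: mulfI; rewrite gt_eqF ?stationary_gt0.
Qed.

(** Dividing each row of [Q] by its sum [q x] gives a stochastic matrix; equality of row and column
    sums says that [q] is stationary for it. *)
Lemma edge_measure_surj (Q : {ffun V * V -> R}) :
    (forall e, e \in D -> 0 < Q e) -> (forall e, e \notin D -> Q e = 0) ->
    (forall x, \sum_x' Q (x, x') = \sum_x' Q (x', x)) ->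
    \sum_x \sum_x' Q (x, x') = 1 ->
  exists P : transition R D, edge_measure P = Q.
Proof.
move=> Q_gt0 Q_eq0 Q_bal Q1.
have Q_ge0 e : 0 <= Q e.
  by have [/Q_gt0/ltW//|/Q_eq0->] := boolP (e \in D).
pose q := [ffun x => \sum_x' Q (x, x')].
have q_gt0 x : 0 < q x.
  have [y xy] := exists_out_edge V_ge2 D_conn x.
  rewrite ffunE (bigD1 y) //= ltr_pwDl ?Q_gt0 //.
  by apply: sumr_ge0.
have q_neq0 x : q x != 0 by rewrite gt_eqF.
pose M := [ffun e : V * V => Q e / q e.1].
have M_trans : is_transition D M.
  apply/andP; split; apply/forallP; [move=> x|move=> e].
    under eq_bigr do rewrite ffunE /=.
    by rewrite -mulr_suml -[X in X / _](ffunE (fun x => \sum_x' Q (x, x'))) divff.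
  rewrite ffunE; case: ifPn => De; first by rewrite divr_gt0 ?Q_gt0.
  by rewrite Q_eq0 ?mul0r.
exists (Transition M_trans).
have -> : edge_measure (Transition M_trans) = [ffun e => q e.1 * M e].
  apply/ffunP => e; rewrite !ffunE /= (@stationaryE _ q) ?ffunE //.
  split=> [x||x'].
  - exact: ltW.
  - by under eq_bigr do rewrite ffunE.
  - rewrite [RHS]ffunE Q_bal; apply: eq_bigr => x _ /=.
    by rewrite [M _]ffunE /= mulrCA divff ?mulr1.
by apply/ffunP => e; rewrite ffunE [M _]ffunE mulrCA divff ?mulr1.
Qed.

(** * Points of the m-geodesic *)

Lemma m_geodesicE (P0 P1 : transition R D) t P :
  edge_measure P = m_mixture P0 P1 t -> m_geodesic P0 P1 t = P.
Proof.
move=> edgeP; apply: edge_measure_inj; rewrite edgeP.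
(* [P] shows that the set is inhabited, so [xget] returns one of its elements. *)
exact: (@xgetI _ P0 [set P | edge_measure P = m_mixture P0 P1 t]%classic P).
Qed.

(** Support, balance and total mass 1 pass to affine combinations for every real [t]; positivity on
    [D] is what [dom_t] provides. *)
Lemma edge_measure_m_geodesic (P0 P1 : transition R D) t :
  m_geodesic_dom P0 P1 t ->
  edge_measure (m_geodesic P0 P1 t) = m_mixture P0 P1 t.
Proof.
move=> dom_t.
have [//|e De|x||P edgeP] := @edge_measure_surj (m_mixture P0 P1 t).
- by rewrite ffunE !edge_measure_eq0 // !mulr0 addr0.
- under eq_bigr do rewrite ffunE; under [RHS]eq_bigr do rewrite ffunE.
  by rewrite !big_split /= -!mulr_sumr !edge_measure_suml !edge_measure_sumr.
- have mix_sum x : \sum_x' m_mixture P0 P1 t (x, x') =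
      (1 - t) * stationary P0 x + t * stationary P1 x.
    under eq_bigr do rewrite ffunE.
    by rewrite big_split /= -!mulr_sumr !edge_measure_suml.
  under eq_bigr do rewrite mix_sum.
  have [_ p0 _] := stationaryP P0; have [_ p1 _] := stationaryP P1.
  by rewrite big_split /= -!mulr_sumr p0 p1 !mulr1 subrK.
- by rewrite (m_geodesicE edgeP).
Qed.

End Transition.

Theorem lemma4p6 (R : realType) (X Y : finType)
    (D : {set X * X}) (E : {set Y * Y})
    (X_ge2 : (1 < #|X|)%N) (Y_ge2 : (1 < #|Y|)%N)
    (D_conn : strongly_connected D) (E_conn : strongly_connected E)
    (Lstar : transition R D -> transition R E)
    (Lstar_mem : memoryless_embedding Lstar)
    (P0 P1 : transition R D) :
  m_geodesic_dom P0 P1 = m_geodesic_dom (Lstar P0) (Lstar P1) /\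
  (forall t : R, m_geodesic_dom P0 P1 t ->
     Lstar (m_geodesic P0 P1 t) = m_geodesic (Lstar P0) (Lstar P1) t).
Proof.
case: Lstar_mem => kappa [L [kappa_surj imD Lambda_pos Lambda_sum LstarE]].
have kappa_edge y y' : (y, y') \in E -> (kappa y, kappa y') \in D.
  by move=> yy'; rewrite -imD; apply/imsetP; exists (y, y').
have edge_lift x : x \in D -> exists2 y, y \in E & x = (kappa y.1, kappa y.2).
  by rewrite -imD => /imsetP.
(* On an edge of [E] entering [y], the positive weight is [L y]. *)
have L_gt0 y : 0 < L y.
  have [y0 y0y] := exists_in_edge Y_ge2 E_conn y.
  have [/(_ y0y) + _] := Lambda_pos y0 y.
  by rewrite /memoryless_weight kappa_edge.
(* Take an edge [(x0, x)] of [D] and [y0] above [x0]: row [y0] of the weight agrees with [L] on the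
   fibre over [x]. *)
have L_sum x : \sum_(y | kappa y == x) L y = 1.
  have [x0 x0x] := exists_in_edge X_ge2 D_conn x.
  have [y0 y0E] := kappa_surj x0; rewrite -y0E in x0x.
  have [_ <-] := Lambda_sum _ _ x0x.
  by apply: eq_bigr => y /eqP yx; rewrite /memoryless_weight yx x0x.
have stationary_Lstar P :
    stationary (Lstar P) = [ffun y => stationary P (kappa y) * L y].
  have [p_ge0 p1 hp] := stationaryP X_ge2 P.
  have sum_fiber (f : X -> R) : \sum_y f (kappa y) * L y = \sum_x f x.
    rewrite (partition_big kappa predT) //=; apply: eq_bigr => x _.
    rewrite -[RHS]mulr1 -(L_sum x) mulr_sumr.
    by apply: eq_bigr => y /eqP->.
  apply: (stationaryE Y_ge2 E_conn); split=> [y||y'].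
  - by rewrite ffunE mulr_ge0 // ltW.
  - by under eq_bigr do rewrite ffunE; rewrite sum_fiber.
  - rewrite ffunE -hp mulr_suml -sum_fiber; apply: eq_bigr => y _.
    by rewrite ffunE LstarE mulrAC !mulrA.
have edge_Lstar P y y' : edge_measure (Lstar P) (y, y') =
    edge_measure P (kappa y, kappa y') * (L y * L y').
  by rewrite !ffunE /= stationary_Lstar ffunE LstarE mulrACA.
have mixture_Lstar t y y' : m_mixture (Lstar P0) (Lstar P1) t (y, y') =
    m_mixture P0 P1 t (kappa y, kappa y') * (L y * L y').
  by rewrite [LHS]ffunE [in RHS]ffunE !edge_Lstar !mulrA -!mulrDl.
split.
  (* The mixtures differ by the positive factor [L y * L y']. Edges of [E] project into [D] for one
     inclusion, and edges of [D] lift to [E] for the other. *)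
  apply/seteqP; split=> t /= dom_t.
    move=> [y y'] /kappa_edge/dom_t.
    by rewrite mixture_Lstar pmulr_lgt0 ?mulr_gt0.
  move=> e /edge_lift[[y y'] /dom_t + ->] /=.
  by rewrite mixture_Lstar pmulr_lgt0 ?mulr_gt0.
(* By [m_geodesicE] it is enough that the image of the geodesic point has the mixture of the image
   edge measures as its edge measure. *)
move=> t dom_t; apply/esym/(m_geodesicE Y_ge2 E_conn)/ffunP => -[y y'].
by rewrite edge_Lstar mixture_Lstar edge_measure_m_geodesic.
Qed.
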